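(* Let $[a,b]$ be an interval and $S$ a finite set of sensors with coverage intervals $[u_s,v_s]$. Suppose continuous OGA (defined in the context) was applied to select a set $S^{\mathrm{old}}\subseteq S$ covering $[a,b]$, and then some sensors $F\subseteq S^{\mathrm{old}}$ fail, producing $m\ge1$ gaps (maximal subintervals of $[a,b]$ no longer covered by $S^{\mathrm{old}}\setminus F$). Assume $S\setminus F$ still covers $[a,b]$. Let $n_{OGA}$ be the number of sensors selected by a new run of continuous OGA on $[a,b]$ using $S\setminus F$, and let $n_{LOGM}$ be the number of sensors in the solution produced by LOGM (defined in the context). Then $n_{OGA}\le n_{LOGM}\le n_{OGA}+(2m-1)$.
   Context: Continuous OGA for covering $[\alpha,\beta]$: set the current point $p=\alpha$; repeatedly select, among the available not-yet-selected sensors whose interval contains $p$, one with the largest right endpoint (ties broken in favor of the longest interval), and set $p$ to that right endpoint; stop once $p\ge\beta$. LOGM (locally optimal gap mending): keep all sensors of $S^{\mathrm{old}}\setminus F$, and for each gap $[u_G,v_G]$ run continuous OGA on that gap, starting from $u_G$ and stopping once $v_G$ is covered, using only sensors of $S$ not in $S^{\mathrm{old}}$ and not already selected; the LOGM solution is the union of the kept and all newly selected sensors. *)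

(* Defs.v *)
From HB Require Import structures.
From mathcomp Require Import all_boot all_order all_algebra.
From mathcomp Require Import reals.

Set Implicit Arguments.
Unset Strict Implicit.
Unset Printing Implicit Defensive.

Import Order.TTheory GRing.Theory Num.Theory.
Local Open Scope ring_scope.

(* Sensors are the elements of a finite type T; sensor s has coverage interval
   [u s, v s].  Distinct sensors may have the same coverage interval. *)

Definition covers (R : realType) (T : finType) (u v : T -> R)
    (A : {set T}) (a b : R) : Prop :=
  forall x, x \in `[a, b] -> exists2 s, s \in A & x \in `[u s, v s].

(* Sensors with the same right endpoint and the same length may remain tied;
   oga_choice then allows any of them, so that oga is a relation. *)
Definition oga_choice (R : realType) (T : finType) (u v : T -> R)
    (A : {set T}) (p : R) (s : T) : Prop :=
  [/\ s \in A, p \in `[u s, v s],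
      forall t, t \in A -> p \in `[u t, v t] -> v t <= v s
    & forall t, t \in A -> p \in `[u t, v t] -> v t = v s ->
        v t - u t <= v s - u s].

(* oga u v beta A p r: from the current point p, with A the set of available
   and not yet selected sensors, continuous OGA can select exactly the sensors
   of r, in this order, before it stops. *)
Inductive oga (R : realType) (T : finType) (u v : T -> R) (beta : R) :
    {set T} -> R -> seq T -> Prop :=
  | oga_stop A p : beta <= p -> oga u v beta A p [::]
  | oga_step A p s r : p < beta -> oga_choice u v A p s ->
      oga u v beta (A :\ s) (v s) r -> oga u v beta A p (s :: r).

Definition oga_selects (R : realType) (T : finType) (u v : T -> R)
    (A : {set T}) (alpha beta : R) (X : {set T}) : Prop :=
  exists2 r, oga u v beta A alpha r & X = [set s in r].

Definition uncovered (R : realType) (T : finType) (u v : T -> R)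
    (A : {set T}) (a b x : R) : Prop :=
  x \in `[a, b] /\ forall s, s \in A -> x \notin `[u s, v s].

(* The inclusion-maximal intervals of uncovered points; these may be open at
   either end, since coverage intervals are closed. *)
Definition is_gap (R : realType) (T : finType) (u v : T -> R)
    (A : {set T}) (a b : R) (I : interval R) : Prop :=
  [/\ exists x, x \in I,
      forall x, x \in I -> uncovered u v A a b x
    & forall J : interval R, {subset I <= J} ->
        (forall x, x \in J -> uncovered u v A a b x) -> {subset J <= I}].

(* Endpoints; the value 0 at an infinite end is irrelevant, since a gap is
   nonempty and bounded. *)
Definition left_end (R : realType) (I : interval R) : R :=
  if I is Interval (BSide _ c) _ then c else 0.
Definition right_end (R : realType) (I : interval R) : R :=
  if I is Interval _ (BSide _ d) then d else 0.

(* mend_gaps u v A gaps r: treating the listed gaps one after the other, each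
   by a run of continuous OGA from its left to its right endpoint, with A the
   set of sensors initially available, selects the sensors of r. *)
Inductive mend_gaps (R : realType) (T : finType) (u v : T -> R) :
    {set T} -> seq (interval R) -> seq T -> Prop :=
  | mend_nil A : mend_gaps u v A [::] [::]
  | mend_cons A I gaps r1 r2 :
      oga u v (right_end I) A (left_end I) r1 ->
      mend_gaps u v (A :\: [set s in r1]) gaps r2 ->
      mend_gaps u v A (I :: gaps) (r1 ++ r2).

Definition logm_selects (R : realType) (T : finType) (u v : T -> R)
    (S Sold F : {set T}) (gaps : seq (interval R)) (X : {set T}) : Prop :=
  exists2 r, mend_gaps u v (S :\: Sold) gaps r
           & X = (Sold :\: F) :|: [set s in r].

(* Main.v *)
(** Optimality of greedy covering gives the lower bound.  For the upper bound,
  attach to each sensor x of the LOGM solution the step (g, v x] of the greedy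
  run (the old one, or the one on a gap) that selected it.  The new run selects
  some y with u y <= g < v y; since y was available in that greedy run,
  v y <= v x, so the step contains v y.  Discarding the last step of each gap
  run, which may overshoot the gap, makes the steps pairwise disjoint, so
  x |-> y is injective on all but m sensors: |Slogm| <= |Snew| + m. *)
Require Import Defs.
From mathcomp Require Import boolp classical_sets set_interval normedtype.
From HB Require Import structures.
From mathcomp Require Import all_boot all_order all_algebra.
From mathcomp Require Import reals.
From mathcomp Require Import lra zify.

Set Implicit Arguments.
Unset Strict Implicit.
Unset Printing Implicit Defensive.

Import Order.TTheory GRing.Theory Num.Theory.
Local Open Scope ring_scope.

(** Finite choice turns the relation into a map, injective because [y] determines [x]; no explicit
    injection has to be written down. *)
Lemma leq_card_rel (T : finType) (A B : {set T}) (P : T -> T -> Prop) :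
  (forall x, x \in A -> exists2 y, y \in B & P x y) ->
  (forall x x' y, x \in A -> x' \in A -> P x y -> P x' y -> x = x') ->
  (#|A| <= #|B|)%N.
Proof.
move=> hex huniq.
have [f hf] : exists f : T -> T, forall x, x \in A -> f x \in B /\ P x (f x).
  apply: (@fin_all_exists _ _ (fun x y => x \in A -> y \in B /\ P x y)) => x.
  case: (boolP (x \in A)) => [/hex[y yB Pxy]|_].
    by exists y.
  by exists x.
have finj : {in A &, injective f}.
  move=> x x' xA x'A efx; apply: (huniq _ _ (f x)) => //; first by case: (hf _ xA).
  by rewrite efx; case: (hf _ x'A).
rewrite -(card_in_imset finj); apply/subset_leq_card/subsetP => _ /imsetP[x xA ->].
by case: (hf _ xA).
Qed.

(** * Runs of continuous OGA *)

Section Greedy.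
Variables (R : realType) (T : finType) (u v : T -> R).
Implicit Types (A X : {set T}) (p g beta : R) (r : seq T) (s t x y z : T).

(** Finiteness of [T] gives one margin for all sensors, in place of a limit argument. *)
Lemma separate_gt (w : T -> R) p :
  exists2 e, 0 < e & forall s, p < w s -> p + e < w s.
Proof.
suff [e e0 he] : exists2 e, 0 < e & forall s, s \in enum T -> p < w s -> p + e < w s.
  by exists e => // s; apply: he; rewrite mem_enum.
elim: (enum T) => [|s r [e e0 he]]; first by exists 1.
have [pws|wsp] := ltP p (w s); last first.
  exists e => // t; rewrite inE => /orP[/eqP-> |/he//]; rewrite ltNge wsp; lra.
exists (Num.min e ((w s - p) / 2)) => [|t].
  by rewrite lt_min e0 /=; lra.
have le1 : Num.min e ((w s - p) / 2) <= e by rewrite ge_min lexx.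
have le2 : Num.min e ((w s - p) / 2) <= (w s - p) / 2 by rewrite ge_min lexx orbT.
rewrite inE => /orP[/eqP-> _|ht pwt]; first by lra.
by have := he _ ht pwt; lra.
Qed.

Lemma oga_sub beta A p r : oga u v beta A p r -> {subset r <= A}.
Proof.
elim=> {A p r} [//|A p s r _ [sA _ _ _] _ IH] x.
by rewrite inE => /orP[/eqP->//|/IH]; rewrite in_setD1 => /andP[].
Qed.

(* A greedy step without progress would exhaust the sensors ending at [p] and
   then be stuck, so a terminating run progresses at every step. *)
Lemma oga_progress beta A p r : oga u v beta A p r -> p < beta ->
  exists2 s, s \in A & u s <= p < v s.
Proof.
elim=> {A p r} [A p bp|A p s r pb [sA ps _ _] _ IH _]; first by rewrite ltNge bp.
move: ps; rewrite in_itv /= => /andP[us pv].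
have [pvs|vsp] := ltP p (v s); first by exists s => //; rewrite us.
have evs : v s = p by apply/eqP; rewrite eq_le vsp pv.
rewrite evs in IH; have [t + ht] := IH pb.
by rewrite in_setD1 => /andP[_ tA]; exists t.
Qed.

Lemma oga_inv beta A p r : oga u v beta A p r ->
  if r is s :: r' return Prop then
    [/\ p < beta, oga_choice u v A p s & oga u v beta (A :\ s) (v s) r']
  else beta <= p.
Proof. by case. Qed.

(** [oga_choice] alone gives only [p <= v s]; strictness follows because the sensor from
    [oga_progress] competes with [s]. *)
Lemma oga_step_inv beta A p s r : oga u v beta A p (s :: r) ->
  [/\ p < beta, s \in A, u s <= p < v s,
      forall t, t \in A -> u t <= p -> p <= v t -> v t <= v s
    & oga u v beta (A :\ s) (v s) r].
Proof.
move=> h; case: (oga_inv h) => pb [sA ps hmax _] hr.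
have hmax' t : t \in A -> u t <= p -> p <= v t -> v t <= v s.
  by move=> tA ut pt; apply: hmax => //; rewrite in_itv /= ut.
split=> //; move: ps; rewrite in_itv /= => /andP[-> _] /=.
have [t tA /andP[ut pt]] := oga_progress h pb.
exact: lt_le_trans pt (hmax' _ tA ut (ltW pt)).
Qed.

Lemma oga_gt beta A p r x : oga u v beta A p r -> x \in r -> p < v x.
Proof.
elim: r A p => [//|s r IH] A p /oga_step_inv[_ _ /andP[_ pvs] _ hr].
by rewrite inE => /orP[/eqP->//|/(IH _ _ hr)]; apply: lt_trans.
Qed.

Lemma oga_inj beta A p r : oga u v beta A p r -> {in r &, injective v}.
Proof.
elim: r A p => [//|s r IH] A p /oga_step_inv[_ _ _ _ hr] x y.
rewrite !inE => /orP[/eqP->|xr] /orP[/eqP->|yr] // exy.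
- by have := oga_gt hr yr; rewrite exy ltxx.
- by have := oga_gt hr xr; rewrite exy ltxx.
- exact: (IH _ _ hr).
Qed.

(** Here [g] is the current point when [x] was selected. Maximality holds against the whole initial
    [A], not just what remained: sensors selected earlier end at or before [g], and [g < v t]
    excludes them. *)
Lemma oga_start beta A p r x : oga u v beta A p r -> x \in r ->
  exists g, [/\ p <= g < beta, u x <= g < v x,
    forall z, z \in r -> v z < v x -> v z <= g,
    forall t, t \in A -> u t <= g -> g < v t -> v t <= v x
  & g = p \/ exists2 z, z \in r & v z = g].
Proof.
elim: r A p => [//|s r IH] A p /oga_step_inv[pb sA hs hmax hr].
have /andP[us pvs] := hs.
rewrite inE => /orP[/eqP->|xr].
  exists p; split=> //; [by rewrite lexx| |by move=> t tA ut /ltW; apply: hmax|by left].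
  move=> z; rewrite inE => /orP[/eqP->|/(oga_gt hr) h1 h2]; first by rewrite ltxx.
  by have := lt_trans h1 h2; rewrite ltxx.
have [g [/andP[sg gb] hx hz ht hg]] := IH _ _ hr xr.
exists g; split=> //.
- by rewrite gb andbT; apply: le_trans sg; exact: ltW.
- by move=> z; rewrite inE => /orP[/eqP->//|]; exact: hz.
- move=> t tA ut gt; apply: ht => //; rewrite in_setD1 tA andbT.
  by apply: contraTneq gt => ->; rewrite -leNgt.
- right; case: hg => [->|[z zr <-]]; first by exists s => //; rewrite mem_head.
  by exists z => //; rewrite inE zr orbT.
Qed.

(** The half-open steps, each from the current point up to the new right endpoint, leave no hole in
    [[p, beta)]; [y] is the sensor whose step contains [g]. *)
Lemma oga_hit beta A p r g : oga u v beta A p r -> p <= g < beta ->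
  exists2 y, y \in r & u y <= g < v y.
Proof.
elim: r A p => [|s r IH] A p.
  by move=> /oga_inv bp /andP[pg]; rewrite ltNge (le_trans bp pg).
move=> /oga_step_inv[_ _ /andP[us _] _ hr] /andP[pg gb].
have [gs|sg] := ltP g (v s).
  by exists s; rewrite ?mem_head // gs (le_trans us pg).
have [|y yr hy] := IH _ _ hr; first by rewrite sg.
by exists y => //; rewrite inE yr orbT.
Qed.

(** Strictness of [p < beta] matters: from [p = beta] the run is empty and covers nothing. *)
Lemma oga_covers beta A p r : oga u v beta A p r -> p < beta ->
  covers u v [set s in r] p beta.
Proof.
move=> h pb w; rewrite in_itv /= => /andP[pw wb].
have [wb'|bw] := ltP w beta.
  have [|y yr /andP[uy wy]] := oga_hit (g := w) h; first by rewrite pw.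
  by exists y; [rewrite inE|rewrite in_itv /= uy ltW].
(* [oga_hit] stops short of [beta], which the last selected sensor covers. *)
have -> : w = beta by apply/eqP; rewrite eq_le wb.
elim: r A p h pb {pw w wb bw} => [|s r IH] A p.
  by move=> /oga_inv bp; rewrite ltNge bp.
move=> /oga_step_inv[pb _ /andP[us _] _ hr] _.
have [bs|sb] := leP beta (v s).
  exists s; first by rewrite !inE eqxx.
  by rewrite in_itv /= bs (le_trans us (ltW pb)).
have [y] := IH _ _ hr sb; rewrite inE => yr hy.
by exists y => //; rewrite !inE yr orbT.
Qed.

(* Covering the half-open interval is stable under dropping a sensor containing
   [p] when passing to the greedy choice; for the closed one it is not. *)
Lemma oga_optimal beta A p r X : oga u v beta A p r -> X \subset A ->
  (forall w, p < w -> w <= beta -> exists2 s, s \in X & u s <= w <= v s) ->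
  (size r <= #|X|)%N.
Proof.
elim: r A p X => [//|s r IH] A p X /oga_step_inv[pb sA /andP[us pvs] hmax hr] XA hX.
(* No sensor starts in [(p, p + e]], so one covering a point just right of [p] also contains [p]. *)
have [x xX /andP[ux pvx]] : exists2 x, x \in X & u x <= p < v x.
  have [e e0 he] := separate_gt u p.
  have [||x xX /andP[ux vx]] := hX (Num.min (p + e) beta).
  - by rewrite lt_min pb andbT; lra.
  - by rewrite ge_min lexx orbT.
  exists x => //; apply/andP; split; last first.
    by apply: lt_le_trans vx; rewrite lt_min pb andbT; lra.
  rewrite leNgt; apply/negP => /he; rewrite ltNge (le_trans ux) //.
  by rewrite ge_min lexx.
have vxs : v x <= v s by apply: hmax; rewrite ?(subsetP XA) // ltW.
(* Neither [x] nor [s] reaches beyond [v s]; [s] is dropped as well because it is no longer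
   available. *)
have : (size r <= #|X :\ x :\ s|)%N.
  apply: (IH _ _ _ hr) => [|w sw wb].
    by apply/subsetP => y; rewrite !inE => /and3P[-> _ /(subsetP XA)].
  have [||y yX /andP[uy wy]] := hX w => //; first exact: lt_trans sw.
  exists y; last by rewrite uy.
  have vsy := lt_le_trans sw wy.
  rewrite !inE yX andbT; apply/andP; split; apply: contraTneq vsy => ->;
  by rewrite -leNgt.
rewrite (cardsD1 x X) xX => /leq_trans h; rewrite add1n ltnS; apply: h.
by rewrite subset_leq_card // subD1set.
Qed.

(** Indexes the runs by their gaps, which needs [uniq gaps]. A sensor missing from the set [B]
    available at [I] was taken by the run of another gap. *)
Lemma mend_gaps_runs A gaps r : mend_gaps u v A gaps r -> uniq gaps ->
  exists2 f : interval R -> seq T, r = flatten (map f gaps) &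
    forall I, I \in gaps -> exists B : {set T}, [/\ B \subset A,
      oga u v (right_end I) B (left_end I) (f I) &
      forall t, t \in A -> t \notin B ->
        exists J, [/\ J \in gaps, J != I & t \in f J]].
Proof.
elim=> {A gaps r} [A _|A I gaps r1 r2 hr1 _ IH]; first by exists (fun=> [::]).
rewrite cons_uniq => /andP[Ig /IH[f -> hf]].
pose f' J := if J == I then r1 else f J.
have f'E J : J \in gaps -> f' J = f J.
  by rewrite /f' => Jg; case: eqVneq => // JI; rewrite -JI Jg in Ig.
have f'I : f' I = r1 by rewrite /f' eqxx.
exists f'; first by rewrite /= f'I; congr (_ ++ flatten _); apply/eq_in_map => J /f'E.
move=> J; rewrite inE => /orP[/eqP->|Jg].
  by exists A; rewrite f'I; split=> // t ->.
have [B [BA hB hout]] := hf _ Jg; exists B; rewrite f'E //; split=> //.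
  by apply: subset_trans BA _; exact: subsetDl.
move=> t tA tB; have [tr|tr] := boolP (t \in r1).
  exists I; rewrite mem_head f'I; split=> //.
  by apply: contraNneq Ig => ->.
have [|//|K [Kg KJ tK]] := hout t; first by rewrite !inE tr tA.
by exists K; rewrite inE Kg orbT KJ f'E.
Qed.

End Greedy.

(** * Gaps as connected components of the uncovered set *)

Section Gaps.
Variables (R : realType) (T : finType) (u v : T -> R) (K : {set T}) (a b : R).
Hypothesis ab : a < b.
Implicit Types (I J : interval R) (x y z w : R).

Local Notation free := (uncovered u v K a b).
Local Notation gap := (is_gap u v K a b).

(** The relation of lying in one component of the uncovered set, symmetric so that the order of [x]
    and [w] need not be known. *)
Definition free_between x w :=
  forall z, (x <= z <= w) || (w <= z <= x) -> free z.

Lemma itv_convex I x y z : x \in I -> y \in I -> x <= z <= y -> z \in I.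
Proof. by move=> xI yI; apply: (@interval_is_interval _ I). Qed.

(** The component is order-convex, hence equal to its real hull, an interval. *)
Lemma component_itv x : exists I, forall w, w \in I <-> free_between x w.
Proof.
have hint : is_interval [set w | free_between x w]%classic.
  move=> p q /= hp hq z /andP[pz zq] w /orP[]/andP[h1 h2].
    by apply: hq; rewrite h1 (le_trans h2 zq).
  by apply: hp; rewrite h2 (le_trans pz h1) orbT.
exists (Rhull [set w | free_between x w]%classic) => w.
have /seteqP[h1 h2] : [set` Rhull [set w | free_between x w]]%classic
    = [set w | free_between x w]%classic by apply: RhullK; apply: mem_set.
by split; [apply: h1|apply: h2].
Qed.

Lemma itv_free_between I x w : x \in I -> w \in I ->
  (forall z, z \in I -> free z) -> free_between x w.
Proof.
by move=> xI wI hI z /orP[]h; apply: hI; [apply: itv_convex xI wI _|apply: itv_convex wI xI _].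
Qed.

Lemma gap_component I x : gap I -> x \in I ->
  forall w, w \in I <-> free_between x w.
Proof.
move=> [_ hI hmax] xI w; split=> [wI|]; first exact: itv_free_between xI wI hI.
have [J hJ] := component_itv x; move/(hJ w); apply: hmax => z.
  by move=> zI; apply/hJ; apply: itv_free_between zI hI.
by move/(hJ z); apply; rewrite !lexx /=; case: leP => //= /ltW ->.
Qed.

Lemma gap_exists x : free x -> exists2 I, gap I & x \in I.
Proof.
move=> fx; have [I hI] := component_itv x.
have xI : x \in I.
  by apply/hI => z; rewrite orbb -eq_le => /eqP <-.
exists I => //; split; first by exists x.
  by move=> z /hI; apply; rewrite !lexx /=; case: leP => //= /ltW ->.
by move=> J IJ hJ w wJ; apply/hI; apply: itv_free_between wJ hJ; exact: IJ.
Qed.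

Lemma gap_eq I J x y : gap I -> gap J -> x \in I -> y \in J ->
  free_between x y -> I = J.
Proof.
move=> gI gJ xI yJ hxy.
have yI : y \in I by apply/(gap_component gI xI).
have IJ : I =i J.
  by move=> w; apply/idP/idP => [/(gap_component gI yI)|/(gap_component gJ yJ)] h;
    [apply/(gap_component gJ yJ)|apply/(gap_component gI yI)].
have ne L : gap L -> L \in neitv.
  by move=> [[z zL] _ _]; apply/set0P; exists z.
(* A nonempty interval is the hull of its points, so equal membership gives equal interval terms. *)
rewrite -(set_itvK (ne _ gI)) -(set_itvK (ne _ gJ)); congr Rhull.
by apply/set_itvP.
Qed.

(** Finitely many closed intervals leave a relatively open uncovered set, so a gap extends to the
    right of [x], or to the left if [x = b]. *)
Lemma gap_two_points I : gap I -> exists x y, [/\ x \in I, y \in I & x < y].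
Proof.
move=> gI; have [[x xI] hI _] := gI; have [] := hI _ xI.
rewrite in_itv /= => /andP[ax xb] hx.
have [e1 e10 he1] := separate_gt u x.
(* Negation yields the margin on the left, for right endpoints below [x]. *)
have [e2 e20 he2] := separate_gt (fun s => - v s) (- x).
have near z : a <= z <= b -> x - e2 <= z <= x + e1 -> free z.
  move=> abz /andP[z1 z2]; split; first by rewrite in_itv.
  move=> s /hx; apply: contra; rewrite !in_itv /= => /andP[uz zv].
  have ux : u s <= x.
    by rewrite leNgt; apply/negP => /he1; rewrite ltNge (le_trans uz z2).
  by rewrite ux leNgt; apply/negP => vx; have := he2 s; rewrite ltrN2 => /(_ vx); lra.
have [xb'|bx] := ltP x b.
  have [m1 m2 m3] : [/\ Num.min (x + e1) b <= x + e1, Num.min (x + e1) b <= b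
      & x < Num.min (x + e1) b].
    by rewrite !ge_min !lexx lt_min xb' orbT andbT; split=> //; lra.
  exists x, (Num.min (x + e1) b); split=> //.
  apply/(gap_component gI xI) => z /orP[]/andP[h1 h2]; apply: near; lra.
have [m1 m2 m3] : [/\ x - e2 <= Num.max (x - e2) a, a <= Num.max (x - e2) a
    & Num.max (x - e2) a < x].
  by rewrite !le_max !lexx gt_max (lt_le_trans ab bx) orbT andbT; split=> //; lra.
exists (Num.max (x - e2) a), x; split=> //.
apply/(gap_component gI xI) => z /orP[]/andP[h1 h2]; apply: near; lra.
Qed.

(** A gap lies in [[a, b]]: an infinite end would admit [a - 1] or [b + 1], and an end outside
    [[a, b]] a midpoint outside it. So the default [0] never arises. *)
Lemma gap_ends I : gap I ->
  [/\ left_end I < right_end I, a <= left_end I, right_end I <= b,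
      forall w, left_end I < w < right_end I -> w \in I
    & forall w, w \in I -> left_end I <= w <= right_end I].
Proof.
move=> gI; have [x [y [+ + xy]]] := gap_two_points gI.
have [_ hI _] := gI =>  xI yI.
have [] := hI _ xI; have [] := hI _ yI.
rewrite !in_itv /= => /andP[_ yb] _ /andP[ax _] _.
move: hI xI yI.
have lteifW c (p q : R) : p < q ?<= if c -> p <= q by case: c => //= /ltW.
have ltWeif c (p q : R) : p < q -> p < q ?<= if c by case: c => //= /ltW.
case: I {gI} => [[cl c|[]] [cr d|[]]] hI //;
  rewrite !in_itv /= ?andbF ?andbT //.
- move=> /andP[/lteifW cx _] /andP[_ /lteifW yd].
  have mem w : c < w < d -> w \in Interval (BSide cl c) (BSide cr d).
    by case/andP=> cw wd; rewrite in_itv /= !ltWeif.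
  have bnd w : c < w < d -> a <= w <= b.
    by move=> /mem/hI[]; rewrite in_itv.
  split=> [|||//|w].
  + lra.
  + rewrite leNgt; apply/negP => ca; have /bnd : c < (c + a) / 2 < d; lra.
  + rewrite leNgt; apply/negP => bd; have /bnd : c < (b + d) / 2 < d; lra.
  + by rewrite in_itv /= => /andP[/lteifW-> /lteifW->].
- move=> /lteifW cx _.
  have /hI[] : b + 1 \in Interval (BSide cl c) +oo%O.
    by rewrite in_itv /= andbT ltWeif //; lra.
  by rewrite in_itv /=; lra.
- move=> _ /lteifW yd.
  have /hI[] : a - 1 \in Interval -oo%O (BSide cr d).
    by rewrite in_itv /= ltWeif //; lra.
  by rewrite in_itv /=; lra.
- have /hI[] : a - 1 \in Interval -oo%O +oo%O by rewrite in_itv.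
  by rewrite in_itv /=; lra.
Qed.

(** The strict inequalities are needed because a gap may be open: the common point must be
    interior. *)
Lemma gap_meets I t : gap I -> u t <= v t -> u t < right_end I ->
  left_end I < v t -> exists2 w, w \in I & u t <= w <= v t.
Proof.
move=> gI; have [cd _ _ mem _] := gap_ends gI.
set c := left_end I in cd mem *; set d := right_end I in cd mem * => utv ud cv.
have [uc|cu] := leP (u t) c; last by exists (u t); rewrite ?lexx // mem // cu.
have [le1 le2 le3] : [/\ Num.min d (v t) <= d, Num.min d (v t) <= v t
    & c < Num.min d (v t)] by rewrite !ge_min !lexx orbT lt_min cd.
by exists ((c + Num.min d (v t)) / 2); [apply: mem|]; lra.
Qed.

Lemma kept_right_of_gap I s : gap I -> s \in K -> u s <= v s ->
  left_end I < v s -> right_end I <= u s.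
Proof.
move=> gI sK us cs; rewrite leNgt; apply/negP => sd.
have [w wI hw] := gap_meets gI us sd cs; have [_ hI _] := gI.
by have [_ /(_ _ sK)] := hI _ wI; rewrite in_itv /= hw.
Qed.

(* A sensor meeting two gaps contains a kept sensor lying between them, so the
   old run would have preferred it to that one. *)
Lemma gap_of_unselected S r t I J x y : oga u v b S a r -> {subset K <= r} ->
  t \in S -> gap I -> gap J -> x \in I -> y \in J ->
  u t <= x <= v t -> u t <= y <= v t -> I = J.
Proof.
move=> hr Kr tS; wlog xy : I J x y / x <= y.
  move=> hw gI gJ xI yJ tx ty; have [xy|/ltW yx] := leP x y.
    exact: (hw _ _ _ _ xy).
  by apply/esym; apply: (hw _ _ _ _ yx).
move=> gI gJ xI yJ /andP[ux _] /andP[_ yv].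
apply: (gap_eq gI gJ xI yJ) => z hz.
have {}hz : x <= z <= y by lra.
have [[_ hI _] [_ hJ _]] := (gI, gJ).
have [xab hx] := hI _ xI; have [yab hy] := hJ _ yJ.
split=> [|s sK]; first by move: xab yab; rewrite !in_itv /=; lra.
apply/negP; rewrite in_itv /= => /andP[uz zv].
have := hx _ sK; rewrite in_itv /= => sx; have := hy _ sK; rewrite in_itv /= => sy.
have [g [_ ug _ hmax _]] := oga_start hr (Kr _ sK).
have xs : x < u s by lra.
have ys : v s < y by lra.
by have := hmax t tS; lra.
Qed.

End Gaps.

(** * The two bounds *)

Theorem theorem6 (R : realType) (T : finType) (u v : T -> R) (a b : R)
    (S Sold F Snew Slogm : {set T}) (m : nat) (gaps : seq (interval R))
    (hab : a <= b)
    (huv : forall s, s \in S -> u s <= v s)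
    (hold : oga_selects u v S a b Sold)
    (hcold : covers u v Sold a b)
    (hF : F \subset Sold)
    (hguniq : uniq gaps)
    (hgaps : forall I : interval R, I \in gaps <-> is_gap u v (Sold :\: F) a b I)
    (hsize : size gaps = m)
    (hm : (1 <= m)%N)
    (hcov : covers u v (S :\: F) a b)
    (hnew : oga_selects u v (S :\: F) a b Snew)
    (hlogm : logm_selects u v S Sold F gaps Slogm) :
  (#|Snew| <= #|Slogm|)%N /\ (#|Slogm| <= #|Snew| + (2 * m - 1))%N.
Proof.
have [ro hro SoldE] := hold; have [rn hrn SnewE] := hnew.
have [r hr SlogmE] := hlogm.
have oldE s : (s \in Sold) = (s \in ro) by rewrite SoldE inE.
have newE s : (s \in Snew) = (s \in rn) by rewrite SnewE inE.
have oldS : Sold \subset S.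
  by apply/subsetP => s; rewrite oldE; apply: (oga_sub hro).
(* If [a = b], the old run selects nothing and cannot cover [a]. *)
have ab : a < b.
  rewrite lt_neqAle hab andbT; apply/eqP => ab; have [|s] := hcold a.
    by rewrite in_itv /= lexx.
  rewrite oldE => sro; have [g [/andP[h1 h2] _ _ _ _]] := oga_start hro sro.
  by have := le_lt_trans h1 h2; rewrite ab ltxx.
set K := Sold :\: F.
have Kro : {subset K <= ro} by move=> s; rewrite inE -oldE => /andP[].
have KS s : s \in K -> s \in S by rewrite inE => /andP[_ /(subsetP oldS)].
have [f rE hf] := mend_gaps_runs hr hguniq.
have runE t : t \in r -> exists2 I, I \in gaps & t \in f I.
  by rewrite rE => /flatten_mapP[I Ig tI]; exists I.
have runr I t : I \in gaps -> t \in f I -> t \in r.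
  by move=> Ig tI; rewrite rE; apply/flatten_mapP; exists I.
have run_out t : t \in r -> t \in S /\ t \notin Sold.
  move=> /runE[I /hf[B [BA hB _]]] /(oga_sub hB)/(subsetP BA).
  by rewrite inE => /andP[].
have logmE s : (s \in Slogm) = (s \in K) || (s \in r) by rewrite SlogmE !inE.
have gapP I : I \in gaps -> is_gap u v K a b I by move/hgaps.
have meets I t : I \in gaps -> t \in f I -> exists2 w, w \in I & u t <= w <= v t.
  move=> Ig tI; have [B [_ hB _]] := hf _ Ig.
  have [g [hg ht _ _ _]] := oga_start hB tI.
  by apply: (gap_meets ab (gapP _ Ig)); lra.
split.
  (* Lower bound: [Slogm] consists of working sensors, new ones being outside [Sold] and hence
     outside [F], and it covers kept points and gaps alike. *)
  have szn : (#|Snew| <= size rn)%N by rewrite SnewE cardsE card_size.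
  apply: leq_trans szn (oga_optimal hrn _ _).
    apply/subsetP => s; rewrite logmE => /orP[sK|/run_out[sS so]]; apply/setDP.
      by split; [exact: KS|by case/setDP: sK].
    by split=> //; apply: contraNN so; apply: (subsetP hF).
  move=> w aw wb.
  have [/existsP[s /andP[sK hs]]|/existsPn noK] :=
      boolP [exists s, (s \in K) && (u s <= w <= v s)].
    by exists s; rewrite // logmE sK.
  have [|I gI wI] := @gap_exists _ _ u v K a b w.
    split=> [|s sK]; first by rewrite in_itv /= wb ltW.
    by have := noK s; rewrite sK in_itv.
  have Ig : I \in gaps by apply/hgaps.
  have [B [_ hB _]] := hf _ Ig.
  have [cd _ _ _ /(_ _ wI) wcd] := gap_ends ab gI.
  have [|s] := oga_covers hB cd (x := w); first by rewrite in_itv.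
  rewrite inE in_itv /= => sI hs; exists s => //.
  by rewrite logmE (runr _ _ Ig sI) orbT.
(* The discarded last steps. *)
pose late I := [set t in f I | right_end I <= v t].
(* A sensor selected after [t] starts from some [g >= v t] still below the right end, so only the
   last sensor of a run can be late. *)
have late1 I : I \in gaps -> (#|late I| <= 1)%N.
  move=> Ig; have [B [_ hB _]] := hf _ Ig.
  have no_lt t t' : t \in f I -> t' \in f I -> right_end I <= v t ->
      v t < v t' -> False.
    move=> tI t'I ct tt'.
    have [g [hg _ /(_ _ tI tt') hz _ _]] := oga_start hB t'I; lra.
  apply/card_le1_eqP => t t'; rewrite !inE => /andP[tI ct] /andP[t'I ct'].
  apply: (oga_inj hB) => //; case: (ltgtP (v t') (v t)) => // tt'.
    by case: (no_lt t' t).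
  by case: (no_lt t t').
pose lates := [set t | has (fun I => t \in late I) gaps].
have latesm : (#|lates| <= m)%N.
  rewrite -hsize /lates; elim: (gaps) late1 {hf hguniq hgaps} => [|I s IH] h1.
    by rewrite (_ : [set _ | _] = set0) ?cards0 //; apply/setP => t; rewrite !inE.
  rewrite (_ : [set _ | _] = late I :|: [set t | has (fun I => t \in late I) s]).
    apply: leq_trans (leq_card_setU _ _) _.
    rewrite /= -add1n leq_add ?h1 ?mem_head // IH // => J Js.
    by rewrite h1 // inE Js orbT.
  by apply/setP => t; rewrite !inE /= !inE.
(* This places [v y] in the step of [x]; [g < v y] is expressed through the earlier right endpoints
   of the run, and [left_end I] for a gap run. *)
pose early y x := 
 [/\ x \in K, v y <= v x & forall z, z \in ro -> v z < v x -> v z < v y] \/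
 exists I, [/\ I \in gaps, x \in f I, v x < right_end I, left_end I < v y <= v x
   & forall z, z \in f I -> v z < v x -> v z < v y].
have card_early : (#|Slogm :\: lates| <= #|Snew|)%N.
  apply: (@leq_card_rel _ _ _ (fun x y => early y x)) => [x|x x' y _ _].
    case/setDP => + xl; rewrite logmE => /orP[xK|/runE[I Ig xI]].
      have xo := Kro _ xK.
      have [g [hg ux hz hmax _]] := oga_start hro xo.
      have [y yn hy] := oga_hit hrn hg; exists y; rewrite ?newE //.
      have /setDP[yS _] := oga_sub hrn yn.
      left; split=> // [|z zo zx]; first by apply: hmax => //; lra.
      by have := hz z zo zx; lra.
    have gI := gapP _ Ig; have [cd ac db mem bnd] := gap_ends ab gI.
    have [B [BA hB hout]] := hf _ Ig.
    have [g [hg ux hz hmax _]] := oga_start hB xI.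
    have [|y yn hy] := oga_hit hrn (g := g); first by lra.
    exists y; rewrite ?newE //; have /setDP[yS yF] := oga_sub hrn yn.
    right; exists I.
    have xd : v x < right_end I.
      rewrite ltNge; apply: contraNN xl => dx.
      by rewrite inE; apply/hasP; exists I; rewrite // inE xI.
    have [w wI hw] : exists2 w, w \in I & u y <= w <= v y.
      by apply: (gap_meets ab gI); lra.
    (* As [y] has not failed, membership in [Sold] would make it kept, yet it meets a gap. *)
    have yo : y \notin Sold.
      apply/negP => yo; have yK : y \in K by rewrite inE yF.
      by have [_ /(_ _ wI)[_ /(_ _ yK)]] := gI; rewrite in_itv /= hw.
    (* Had the run of another gap taken [y], then [y] would meet two gaps. *)
    have yB : y \in B.
      apply: contraT => /(hout y)[]; first by rewrite inE yo.
      move=> J [Jg JI yJ]; have [w' w'J hw'] := meets _ _ Jg yJ.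
      case/eqP: JI; apply: (gap_of_unselected hro Kro yS _ _ w'J wI) => //;
      exact: gapP.
    split=> //; last by move=> z zI zx; have := hz z zI zx; lra.
    have := hmax y yB; lra.
  (* Since [z'] is not late, [v y] is below the right end of the gap, whereas the step of the kept
     [z] starts at or beyond that end. *)
  have kept_run z z' I : z \in K -> v y <= v z ->
      (forall t, t \in ro -> v t < v z -> v t < v y) ->
      I \in gaps -> v z' < right_end I -> left_end I < v y <= v z' -> False.
    move=> zK yz hz Ig z'd hy.
    have dz : right_end I <= u z.
      by apply: (kept_right_of_gap ab (gapP _ Ig) zK); rewrite ?huv ?KS //; lra.
    have [g [hg uz hlt _ hga]] := oga_start hro (Kro _ zK).
    have [cd ac _ _ _] := gap_ends ab (gapP _ Ig).
    case: hga => [ga|[t tro tg]]; first by lra.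
    by have := hz t tro; lra.
  case=> [[xK yx hx]|[I [Ig xI xd hyx hx]]]
    [[x'K yx' hx']|[I' [I'g x'I xd' hyx' hx']]].
  (* If [v x < v x'], then [v x < v y] by [hx'], against [v y <= v x]; the other order is
     symmetric. *)
  - apply: (oga_inj hro); rewrite ?Kro //.
    case: (ltgtP (v x) (v x')) => // [/hx'|/hx].
      by move=> /(_ (Kro _ xK)); lra.
    by move=> /(_ (Kro _ x'K)); lra.
  - by case: (kept_run x x' I').
  - by case: (kept_run x' x I).
  - have [cd ac db mem bnd] := gap_ends ab (gapP _ Ig).
    have [cd' ac' db' mem' bnd'] := gap_ends ab (gapP _ I'g).
    have yI : v y \in I by apply: mem; lra.
    have yI' : v y \in I' by apply: mem'; lra.
    (* The point [v y] is interior to both gaps. *)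
    have eI : I = I'.
      apply: (gap_eq (gapP _ Ig) (gapP _ I'g) yI yI') => z hz.
      have -> : z = v y by move: hz; rewrite orbb -eq_le => /eqP.
      by have [_ /(_ _ yI)] := gapP _ Ig.
    rewrite -eI in x'I hx'.
    have [B [_ hB _]] := hf _ Ig.
    apply: (oga_inj hB) => //.
    case: (ltgtP (v x) (v x')) => // [/hx'|/hx].
      by move=> /(_ xI); lra.
    by move=> /(_ x'I); lra.
(* This gives [#|Slogm| <= #|Snew| + m], and [m <= 2 * m - 1] as [m >= 1]. *)
have := cardsID lates Slogm.
have : (#|Slogm :&: lates| <= m)%N.
  by apply: leq_trans latesm; rewrite subset_leq_card // subsetIr.
by move: card_early hm; lia.
Qed.
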